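(* Let $\alpha\in(0,1)\setminus\mathbb{Q}$. There is $\beta_0>0$ such that for every irrational $\beta\in(0,\beta_0)$ and every $p\in(0,1)$ the following holds. Let $i_1,i_2,\dots$ be i.i.d. random variables with $\mathbb{P}(i_n=1)=p$, $\mathbb{P}(i_n=2)=1-p$, and let $F_n=T_{i_1}\circ T_{i_2}\circ\dots\circ T_{i_n}$. Then almost surely $\lim_{n\to\infty}\mathrm{Leb}(F_n(\mathbb{S}))=0$.
   Context: $\mathbb{S}=\mathbb{R}/\mathbb{Z}$ with Lebesgue measure, points represented by $y\in[0,1)$. Let $\delta=1-\alpha$. $T_1(y)=y+\alpha \bmod 1$. $T_2$ is the double rotation $T_2(y)=y+\alpha+\beta\bmod 1$ if $y\le\delta$, and $T_2(y)=y+\alpha\bmod1$ if $y>\delta$. *)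

(* Defs.v *)
From Stdlib Require Import Reals List.
Open Scope R_scope.

Definition irrational (x : R) : Prop :=
  ~ exists (m : Z) (n : nat), x = IZR m / INR (S n).

(* The circle S = R/Z, points represented by y in [0,1); reduction mod 1. *)
Definition mod1 (x : R) : R := frac_part x.

Definition T1 (alpha : R) (y : R) : R := mod1 (y + alpha).

(* T_2 : double rotation, delta = 1 - alpha *)
Definition T2 (alpha beta : R) (y : R) : R :=
  if Rle_dec y (1 - alpha) then mod1 (y + alpha + beta) else mod1 (y + alpha).

(* A symbol sequence: omega n = true means i_{n+1} = 1, false means i_{n+1} = 2. *)
Definition Tsel (alpha beta : R) (b : bool) : R -> R :=
  if b then T1 alpha else T2 alpha beta.

Fixpoint Fn (alpha beta : R) (omega : nat -> bool) (n : nat) (y : R) : R :=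
  match n with
  | O => y
  | S k => Fn alpha beta omega k (Tsel alpha beta (omega k) y)
  end.

Definition image_Fn (alpha beta : R) (omega : nat -> bool) (n : nat) (x : R) : Prop :=
  exists y, 0 <= y < 1 /\ x = Fn alpha beta omega n y.

Definition leb_outer_lt (A : R -> Prop) (eps : R) : Prop :=
  exists (a b : nat -> R) (l : R),
    (forall k, a k <= b k) /\
    (forall x, A x -> exists k, a k <= x <= b k) /\
    (forall N, sum_f_R0 (fun k => b k - a k) N <= l) /\ l < eps.

Definition leb_tends_to_zero (A : nat -> R -> Prop) : Prop :=
  forall eps, 0 < eps -> exists N, forall n, (N <= n)%nat -> leb_outer_lt (A n) eps.

Definition in_cylinder (w : list bool) (omega : nat -> bool) : Prop :=
  forall i, (i < length w)%nat -> omega i = nth i w false.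

Fixpoint cyl_weight (p : R) (w : list bool) : R :=
  match w with
  | nil => 1
  | b :: w' => (if b then p else 1 - p) * cyl_weight p w'
  end.

Definition bernoulli_null (p : R) (E : (nat -> bool) -> Prop) : Prop :=
  forall eps, 0 < eps -> exists (w : nat -> list bool) (l : R),
    (forall omega, E omega -> exists k, in_cylinder (w k) omega) /\
    (forall N, sum_f_R0 (fun k => cyl_weight p (w k)) N <= l) /\ l < eps.

Definition almost_surely (p : R) (P : (nat -> bool) -> Prop) : Prop :=
  bernoulli_null p (fun omega => ~ P omega).

(* Main.v *)
Require Import Defs.
From Stdlib Require Import Reals List Lra Lia Psatz ZArith ClassicalEpsilon Classical.
Open Scope R_scope.

(* Every [T_i] sends the [beta]-orbit of [x] to the [beta]-orbit of [x + alpha],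
   and acts on the index [j] of a point [x + j beta] by a nondecreasing map that
   adds [0] or [1].  By irrationality of [alpha], rotating brings any two orbit
   points on opposite sides of the discontinuity [delta], where [T_2] lowers
   their index gap by one; so points with gap at most [K] merge within [N(K)]
   steps with probability at least [q(K) > 0].  Since the gaps between [J]
   consecutive orbit points sum to at most [J + t] after [t] steps, the expected
   number of distinct images among them contracts to about [J / K].  Averaging
   over the [beta]-orbits of the points of a fine grid turns this into
   [E Leb(F_n(S)) -> 0], and monotonicity of [F_n(S)] in [n] gives almost sure
   convergence. *)

(** * Reduction modulo 1 *)

Lemma mod1_bounds (x : R) : 0 <= mod1 x < 1.
Proof. unfold mod1; destruct (base_fp x); lra. Qed.

Lemma mod1_decomp (x : R) : exists k : Z, x = mod1 x + IZR k.
Proof. exists (Int_part x); unfold mod1, frac_part; ring. Qed.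

Lemma mod1_unique (x z : R) (k : Z) : 0 <= z < 1 -> x = z + IZR k -> mod1 x = z.
Proof.
  intros Hz E; destruct (mod1_decomp x) as [h Hh]; pose proof (mod1_bounds x).
  assert (k = h).
  { assert (k - h < 1)%Z by (apply lt_IZR; rewrite minus_IZR; lra).
    assert (-1 < k - h)%Z by (apply lt_IZR; rewrite minus_IZR; lra).
    lia. }
  subst k; lra.
Qed.

Lemma mod1_shift (x y : R) (k : Z) : x = y + IZR k -> mod1 x = mod1 y.
Proof.
  intros E; destruct (mod1_decomp y) as [h Hh].
  apply (mod1_unique _ _ (h + k)); [apply mod1_bounds | rewrite plus_IZR; lra].
Qed.

Lemma mod1_id (x : R) : 0 <= x < 1 -> mod1 x = x.
Proof. intros H; apply (mod1_unique _ _ 0); lra. Qed.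

Lemma mod1_plus_mod1 (x y : R) : mod1 (mod1 x + y) = mod1 (x + y).
Proof.
  destruct (mod1_decomp x) as [k Hk]; apply (mod1_shift _ _ (- k)).
  rewrite opp_IZR; lra.
Qed.

Lemma mod1_eq (x y : R) : mod1 x = mod1 y -> exists k : Z, x = y + IZR k.
Proof.
  intros E; destruct (mod1_decomp x) as [k Hk]; destruct (mod1_decomp y) as [h Hh].
  exists (k - h)%Z; rewrite minus_IZR; lra.
Qed.

(** * Irrational rotations *)

(** For [q <> 0] the fraction [s / q] would equal [a]; the sign of [q] moves to the numerator
    because [irrational] speaks of positive denominators only. *)
Lemma irrational_mult (a : R) (q s : Z) : irrational a -> IZR q * a = IZR s -> q = 0%Z.
Proof.
  intros Ha E; destruct (Z.eq_dec q 0) as [|Hq]; [assumption | exfalso; apply Ha].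
  exists (s * Z.sgn q)%Z, (Z.to_nat (Z.abs q - 1)).
  rewrite S_INR, INR_IZR_INZ, Z2Nat.id, <- plus_IZR by lia.
  replace (Z.abs q - 1 + 1)%Z with (q * Z.sgn q)%Z by lia.
  assert (q * Z.sgn q <> 0)%Z by lia.
  assert (IZR (q * Z.sgn q) <> 0) by (apply not_0_IZR; assumption).
  rewrite !mult_IZR in *; rewrite <- E; field.
  split; intros Z0; rewrite Z0 in *; lra.
Qed.

(* Euclid's step: [1] leaves modulo [r] a remainder [rho], and [rho] or [r - rho]
   is at most [r / 2]. *)
Lemma small_combination (a : R) (n : nat) :
  irrational a -> exists q s : Z, q <> 0%Z /\ 0 < IZR q * a + IZR s <= (/ 2) ^ n.
Proof.
  intros Ha; induction n as [|n [q [s [Hq IH]]]].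
  - exists 1%Z, (- Int_part a)%Z; split; [lia | rewrite opp_IZR; simpl].
    destruct (base_Int_part a).
    assert (a <> IZR (Int_part a)).
    { intros E; assert (1 = 0)%Z; [apply (irrational_mult a _ (Int_part a) Ha) | lia].
      lra. }
    lra.
  - set (r := IZR q * a + IZR s) in *.
    assert (Hr1 : r <= 1).
    { apply Rle_trans with (1 := proj2 IH); rewrite <- (pow1 n).
      apply pow_incr; lra. }
    assert (Hm : exists m : Z, 0 <= 1 - IZR m * r < r).
    { exists (Int_part (1 / r)); destruct (base_Int_part (1 / r)) as [H1 H2].
      assert (E : 1 / r * r = 1) by (field; lra).
      split; nra. }
    destruct Hm as [m Hm].
    assert (0 < m)%Z.
    { assert (0 <= m)%Z.
      { assert (-1 < m)%Z by (apply lt_IZR; nra). lia. }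
      assert (m <> 0)%Z by (intros ->; lra). lia. }
    change ((/ 2) ^ S n) with (/ 2 * (/ 2) ^ n).
    destruct (Rle_dec (1 - IZR m * r) (r / 2)) as [H'|H'].
    (* A zero remainder would make [a] rational. *)
    + assert (NZ : 1 - IZR m * r <> 0).
      { intros Z0; assert (m * q = 0)%Z; [|lia].
        apply (irrational_mult a _ (1 - m * s) Ha).
        rewrite minus_IZR, !mult_IZR; unfold r in Z0; lra. }
      exists (- (m * q))%Z, (1 - m * s)%Z; split; [lia|].
      rewrite opp_IZR, minus_IZR, !mult_IZR; unfold r in *; nra.
    (* This is [r - rho = (m + 1) * r - 1], positive since [rho < r]. *)
    + exists ((m + 1) * q)%Z, ((m + 1) * s - 1)%Z; split; [lia|].
      rewrite minus_IZR, !mult_IZR, plus_IZR; unfold r in *; nra.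
Qed.

(** Rotating [|q|] times by [a] moves a point by [r < v - u] in a fixed direction, so the interval
    cannot be jumped over. The number of such moves is bounded through [r] alone, which makes [N]
    independent of [x]. *)
Lemma rotation_hits_interval (a u v : R) :
  irrational a -> 0 <= u -> u < v -> v <= 1 ->
  exists N : nat, forall x, exists m : nat, (m < N)%nat /\ u < mod1 (x + INR m * a) < v.
Proof.
  intros Ha Hu Huv Hv.
  destruct (pow_lt_1_zero (/ 2) ltac:(rewrite Rabs_pos_eq; lra) (v - u) ltac:(lra)) as [n Hn].
  specialize (Hn n (Nat.le_refl n)); rewrite Rabs_pos_eq in Hn by (apply pow_le; lra).
  destruct (small_combination a n Ha) as [q [s [Hq [Hr0 Hr]]]].
  set (r := IZR q * a + IZR s) in *.
  set (Q := Z.to_nat (Z.abs q)).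
  assert (HQ : INR Q = IZR (Z.abs q)) by (unfold Q; rewrite INR_IZR_INZ, Z2Nat.id by lia; reflexivity).
  destruct (INR_unbounded (4 / r)) as [B HB].
  exists (S (B * Q)); intros x.
  (* A walk with step [r] first passes [z] by at most [r]. Distance 3 covers both uses below, and
     [3 / r + 1 <= 4 / r] bounds the number of steps. *)
  assert (Hl : forall y z : R, y < z -> z - y <= 3 -> exists i : nat, (i <= B)%nat /\ z < y + INR i * r <= z + r).
  { intros y z H1 H2; destruct (archimed ((z - y) / r)) as [A1 A2].
    assert (E : (z - y) / r * r = z - y) by (field; lra).
    assert (0 < (z - y) / r) by (apply Rdiv_lt_0_compat; lra).
    assert (0 <= up ((z - y) / r))%Z by (apply le_IZR; lra).
    exists (Z.to_nat (up ((z - y) / r))).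
    assert (EI : INR (Z.to_nat (up ((z - y) / r))) = IZR (up ((z - y) / r)))
      by (rewrite INR_IZR_INZ, Z2Nat.id by lia; reflexivity).
    split.
    - apply INR_le; rewrite EI; apply Rlt_le, Rle_lt_trans with (2 := HB).
      assert (r <= 1) by lra.
      assert ((z - y) / r + 1 <= 4 / r); [|lra].
      apply Rmult_le_reg_r with r; [lra|].
      replace (4 / r * r) with 4 by (field; lra); nra.
    - rewrite EI; split; nra. }
  destruct (mod1_decomp x) as [k Hk]; pose proof (mod1_bounds x).
  destruct (Z.lt_ge_cases 0 q) as [Hs|Hs].
  (* The target [u + 1] lies ahead of [mod1 x]; one full turn is subtracted at the end. *)
  - destruct (Hl (mod1 x) (u + 1) ltac:(lra) ltac:(lra)) as [i [Hi Hi']].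
    exists (i * Q)%nat; split; [nia|].
    assert (E : mod1 (x + INR (i * Q) * a) = mod1 x + INR i * r - 1); [|lra].
    apply (mod1_unique _ _ (k - Z.of_nat i * s + 1)%Z); [lra|].
    rewrite mult_INR, HQ, Z.abs_eq, plus_IZR, minus_IZR, mult_IZR, <- INR_IZR_INZ by lia.
    unfold r; lra.
  - (* for [q < 0] the rotation by [|q| a] moves backwards by [r] *)
    destruct (Hl (- mod1 x) (2 - v) ltac:(lra) ltac:(lra)) as [i [Hi Hi']].
    exists (i * Q)%nat; split; [nia|].
    assert (E : mod1 (x + INR (i * Q) * a) = mod1 x - INR i * r + 2); [|lra].
    apply (mod1_unique _ _ (k + Z.of_nat i * s - 2)%Z); [lra|].
    rewrite mult_INR, HQ, Z.abs_neq, opp_IZR, minus_IZR, plus_IZR, mult_IZR, <- INR_IZR_INZ by lia.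
    unfold r; lra.
Qed.

(** * Action of words on the circle and on orbit indices *)

(** The head letter is the outermost map, so the word of [i_1, ..., i_n] acts as [F_n]. *)
Fixpoint act (alpha beta : R) (w : list bool) (y : R) : R :=
  match w with
  | nil => y
  | b :: w' => Tsel alpha beta b (act alpha beta w' y)
  end.

(* [T_i] sends the orbit point [x + j beta] to [x + alpha + j' beta], where
   [j' = bump i x j] is [j] or [j + 1]. *)
Definition bump (alpha beta : R) (b : bool) (x : R) (j : nat) : nat :=
  if b then j else
  if Rle_dec (mod1 (x + INR j * beta)) (1 - alpha) then S j else j.

Fixpoint idx (alpha beta : R) (w : list bool) (x : R) (j : nat) : nat :=
  match w with
  | nil => j
  | b :: w' => bump alpha beta b (x + INR (length w') * alpha) (idx alpha beta w' x j)
  end.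

Lemma act_app (alpha beta : R) (u w : list bool) (y : R) :
  act alpha beta (u ++ w) y = act alpha beta u (act alpha beta w y).
Proof. induction u as [|b u IH]; simpl; [|rewrite IH]; reflexivity. Qed.

Lemma Tsel_bounds (alpha beta : R) (b : bool) (y : R) : 0 <= Tsel alpha beta b y < 1.
Proof.
  unfold Tsel, T1, T2; destruct b; [|destruct Rle_dec]; apply mod1_bounds.
Qed.

Lemma act_bounds (alpha beta : R) (w : list bool) (y : R) :
  0 <= y < 1 -> 0 <= act alpha beta w y < 1.
Proof. intros H; destruct w; simpl; [assumption | apply Tsel_bounds]. Qed.

Lemma Tsel_orbit (alpha beta : R) (b : bool) (x : R) (j : nat) :
  Tsel alpha beta b (mod1 (x + INR j * beta)) =
  mod1 (x + alpha + INR (bump alpha beta b x j) * beta).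
Proof.
  unfold Tsel, T1, T2, bump; destruct b; [|destruct Rle_dec];
    rewrite ?Rplus_assoc, mod1_plus_mod1, ?S_INR; f_equal; ring.
Qed.

Lemma act_orbit (alpha beta : R) (w : list bool) (x : R) (j : nat) :
  act alpha beta w (mod1 (x + INR j * beta)) =
  mod1 (x + INR (length w) * alpha + INR (idx alpha beta w x j) * beta).
Proof.
  induction w as [|b w IH].
  - simpl; f_equal; ring.
  - cbn [act idx]; rewrite IH, Tsel_orbit; cbn [length]; rewrite S_INR; f_equal; ring.
Qed.

Lemma idx_app (alpha beta : R) (u w : list bool) (x : R) (j : nat) :
  idx alpha beta (u ++ w) x j =
  idx alpha beta u (x + INR (length w) * alpha) (idx alpha beta w x j).
Proof.
  induction u as [|b u IH]; simpl; [reflexivity|].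
  rewrite IH, length_app, plus_INR; f_equal; ring.
Qed.

Lemma idx_repeat_true (alpha beta : R) (m : nat) (x : R) (j : nat) :
  idx alpha beta (repeat true m) x j = j.
Proof. induction m; simpl; assumption || reflexivity. Qed.

Lemma bump_le (alpha beta : R) (b : bool) (x : R) (j : nat) :
  (j <= bump alpha beta b x j <= S j)%nat.
Proof. unfold bump; destruct b; [|destruct Rle_dec]; lia. Qed.

Lemma idx_le (alpha beta : R) (w : list bool) (x : R) (j : nat) :
  (idx alpha beta w x j <= j + length w)%nat.
Proof.
  induction w as [|b w IH]; simpl; [lia|].
  pose proof (bump_le alpha beta b (x + INR (length w) * alpha) (idx alpha beta w x j)); lia.
Qed.

(** Equal indices are bumped equally, and distinct ones differ by at least one while a bump adds at
    most one; so points can merge but never overtake. *)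
Lemma idx_mono (alpha beta : R) (w : list bool) (x : R) (j : nat) :
  (idx alpha beta w x j <= idx alpha beta w x (S j))%nat.
Proof.
  induction w as [|b w IH]; simpl; [lia|].
  set (y := x + _); destruct (Nat.eq_dec (idx alpha beta w x j) (idx alpha beta w x (S j))) as [->|].
  - lia.
  - pose proof (bump_le alpha beta b y (idx alpha beta w x j)).
    pose proof (bump_le alpha beta b y (idx alpha beta w x (S j))); lia.
Qed.

(** * Coalescence of two orbit points *)

(** Let [t] be the fractional part of [(k + 1) * beta], nonzero by irrationality. The bounds on [y]
    place it before [1 - alpha], push [y + t] beyond [1 - alpha], and keep [y + t] below 1, so that
    nothing wraps around. *)
Lemma straddle_interval (alpha beta : R) (k : nat) :
  0 < alpha < 1 -> irrational beta ->
  exists u v, 0 <= u /\ u < v /\ v <= 1 /\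
    forall y, u < mod1 y < v ->
      mod1 y <= 1 - alpha /\ 1 - alpha < mod1 (y + INR (S k) * beta).
Proof.
  intros Ha Hb; set (t := mod1 (INR (S k) * beta)).
  pose proof (mod1_bounds (INR (S k) * beta)) as Ht; fold t in Ht.
  destruct (mod1_decomp (INR (S k) * beta)) as [h Hh]; fold t in Hh.
  assert (t <> 0).
  { intros E; assert (Z.of_nat (S k) = 0)%Z; [|lia].
    apply (irrational_mult beta _ h Hb); rewrite <- INR_IZR_INZ; lra. }
  exists (Rmax 0 (1 - alpha - t)), (Rmin (1 - alpha) (1 - t)).
  split; [apply Rmax_l|]; split.
  { apply Rmax_lub_lt; apply Rmin_glb_lt; lra. }
  split; [apply Rle_trans with (1 := Rmin_l _ _); lra|].
  intros y [H1 H2]; destruct (mod1_decomp y) as [g Hg].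
  pose proof (Rmax_l 0 (1 - alpha - t)); pose proof (Rmax_r 0 (1 - alpha - t)).
  pose proof (Rmin_l (1 - alpha) (1 - t)); pose proof (Rmin_r (1 - alpha) (1 - t)).
  rewrite (mod1_unique (y + _) (mod1 y + t) (g + h)); [lra | lra | rewrite plus_IZR; lra].
Qed.

(* A rotation word brings the pair to a position where [T_2] moves only the
   rear point, which lowers the index gap by one. *)
Lemma coalescing_word (alpha beta : R) (k : nat) :
  0 < alpha < 1 -> irrational alpha -> irrational beta ->
  exists N, forall x j, exists w, length w = N /\
    idx alpha beta w x (j + k) = idx alpha beta w x j.
Proof.
  intros Ha Hia Hib; induction k as [|k [N IH]].
  - exists 0%nat; intros x j; exists nil; split; [reflexivity | simpl; lia].
  - destruct (straddle_interval alpha beta k Ha Hib) as [u [v [Hu [Huv [Hv Hs]]]]].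
    destruct (rotation_hits_interval alpha u v Hia Hu Huv Hv) as [N0 HN0].
    exists (N + N0)%nat; intros x j.
    destruct (HN0 (x + INR j * beta)) as [m [Hm Hm']].
    destruct (Hs _ Hm') as [H1 H2].
    (* Read from the right: [m] rotations bring the pair into position, one [T_2] acts, and further
       rotations pad the length to [N0]. *)
    set (w := repeat true (N0 - S m) ++ false :: repeat true m).
    assert (Hw : length w = N0).
    { unfold w; rewrite length_app; simpl; rewrite !repeat_length; lia. }
    (* After [w] the rear index is [S j] and the front one is still [j + S k = S j + k], so the gap
       is [k]. *)
    destruct (IH (x + INR N0 * alpha) (S j)) as [w' [Hw' E]].
    exists (w' ++ w); split; [rewrite length_app; lia|].
    rewrite !idx_app, Hw.
    replace (idx alpha beta w x j) with (S j).
    replace (idx alpha beta w x (j + S k)) with (S j + k)%nat; [assumption|].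
    + unfold w; rewrite idx_app, idx_repeat_true; cbn [idx]; rewrite idx_repeat_true, repeat_length.
      unfold bump; destruct Rle_dec as [H|_]; [|lia].
      rewrite plus_INR in H; exfalso.
      replace (x + INR m * alpha + (INR j + INR (S k)) * beta) with
        (x + INR j * beta + INR m * alpha + INR (S k) * beta) in H by ring.
      lra.
    + unfold w; rewrite idx_app, idx_repeat_true; cbn [idx]; rewrite idx_repeat_true, repeat_length.
      unfold bump; destruct Rle_dec as [_|H]; [reflexivity|].
      exfalso; apply H.
      replace (x + INR m * alpha + INR j * beta) with
        (x + INR j * beta + INR m * alpha) by ring; assumption.
Qed.

(** Rotations applied after merging leave the indices alone, so the words for different gaps can be
    padded to a common length. *)
Lemma coalescing_word_uniform (alpha beta : R) (K : nat) :
  0 < alpha < 1 -> irrational alpha -> irrational beta ->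
  exists N, forall k x j, (k <= K)%nat -> exists w, length w = N /\
    idx alpha beta w x (j + k) = idx alpha beta w x j.
Proof.
  intros Ha Hia Hib; induction K as [|K [N IH]].
  - destruct (coalescing_word alpha beta 0 Ha Hia Hib) as [N HN].
    exists N; intros k x j Hk; replace k with 0%nat by lia; apply HN.
  - destruct (coalescing_word alpha beta (S K) Ha Hia Hib) as [N' HN'].
    exists (N + N')%nat; intros k x j Hk.
    destruct (Nat.eq_dec k (S K)) as [->|].
    + destruct (HN' x j) as [w [Hw E]]; exists (repeat true N ++ w).
      rewrite length_app, repeat_length, !idx_app, !idx_repeat_true; split; [lia | assumption].
    + destruct (IH k x j ltac:(lia)) as [w [Hw E]]; exists (repeat true N' ++ w).
      rewrite length_app, repeat_length, !idx_app, !idx_repeat_true; split; [lia | assumption].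
Qed.

(** * Finite sums and indicators *)

Fixpoint rsum (f : nat -> R) (n : nat) : R :=
  match n with O => 0 | S k => rsum f k + f k end.

Lemma rsum_le (f g : nat -> R) (n : nat) :
  (forall i, (i < n)%nat -> f i <= g i) -> rsum f n <= rsum g n.
Proof.
  induction n as [|n IH]; simpl; intros H; [lra|].
  apply Rplus_le_compat; [apply IH; intros; apply H; lia | apply H; lia].
Qed.

Lemma rsum_ext (f g : nat -> R) (n : nat) :
  (forall i, (i < n)%nat -> f i = g i) -> rsum f n = rsum g n.
Proof.
  induction n as [|n IH]; simpl; intros H; [lra|].
  rewrite IH by (intros; apply H; lia); rewrite H by lia; reflexivity.
Qed.

Lemma rsum_plus (f g : nat -> R) (n : nat) :
  rsum (fun i => f i + g i) n = rsum f n + rsum g n.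
Proof. induction n as [|n IH]; simpl; [|rewrite IH]; ring. Qed.

Lemma rsum_scal (c : R) (f : nat -> R) (n : nat) :
  rsum (fun i => c * f i) n = c * rsum f n.
Proof. induction n as [|n IH]; simpl; [|rewrite IH]; ring. Qed.

Lemma rsum_const (c : R) (n : nat) : rsum (fun _ => c) n = INR n * c.
Proof. induction n as [|n IH]; [simpl; ring | cbn [rsum]; rewrite IH, S_INR; ring]. Qed.

Lemma rsum_nonneg (f : nat -> R) (n : nat) :
  (forall i, (i < n)%nat -> 0 <= f i) -> 0 <= rsum f n.
Proof.
  intros H; rewrite <- (Rmult_0_r (INR n)), <- rsum_const; apply rsum_le; exact H.
Qed.

Lemma rsum_swap (f : nat -> nat -> R) (m n : nat) :
  rsum (fun i => rsum (f i) n) m = rsum (fun j => rsum (fun i => f i j) m) n.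
Proof.
  induction m as [|m IH]; simpl.
  - rewrite rsum_const; ring.
  - rewrite IH, <- rsum_plus; reflexivity.
Qed.

Lemma rsum_telescope (f : nat -> R) (n : nat) :
  rsum (fun i => f (S i) - f i) n = f n - f 0%nat.
Proof. induction n as [|n IH]; simpl; [|rewrite IH]; ring. Qed.

Lemma rsum_ge_term (f : nat -> R) (n i : nat) :
  (forall j, 0 <= f j) -> (i < n)%nat -> f i <= rsum f n.
Proof.
  intros H; induction n as [|n IH]; simpl; intros Hi; [lia|].
  destruct (Nat.eq_dec i n) as [->|].
  - pose proof (rsum_nonneg f n (fun j _ => H j)); lra.
  - pose proof (IH ltac:(lia)); pose proof (H n); lra.
Qed.

Definition indic (P : Prop) : R := if excluded_middle_informative P then 1 else 0.

Lemma indic_bounds (P : Prop) : 0 <= indic P <= 1.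
Proof. unfold indic; destruct excluded_middle_informative; lra. Qed.

Lemma indic_true (P : Prop) : P -> indic P = 1.
Proof. unfold indic; destruct excluded_middle_informative; tauto. Qed.

Lemma indic_false (P : Prop) : ~ P -> indic P = 0.
Proof. unfold indic; destruct excluded_middle_informative; tauto. Qed.

Lemma indic_le (P : Prop) (r : R) : 0 <= r -> (P -> 1 <= r) -> indic P <= r.
Proof. unfold indic; destruct excluded_middle_informative; tauto. Qed.

Lemma indic_mono (P Q : Prop) : (P -> Q) -> indic P <= indic Q.
Proof.
  intros H; apply indic_le; [apply indic_bounds|]; intros p; rewrite indic_true by tauto; lra.
Qed.

Lemma rsum_indic_unique (P : nat -> Prop) (n : nat) :
  (forall i j, P i -> P j -> i = j) -> rsum (fun i => indic (P i)) n <= 1.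
Proof.
  intros H; destruct (classic (exists i, (i < n)%nat /\ P i)) as [[i [Hi Pi]]|No].
  - apply Rle_trans with (rsum (fun j => indic (j = i)) n).
    + apply rsum_le; intros j _; apply indic_mono; intros Pj; apply H; assumption.
    + clear; assert (E : forall m, (m <= i)%nat -> rsum (fun j => indic (j = i)) m = 0).
      { induction m as [|m IH]; simpl; intros Hm; [reflexivity|].
        rewrite IH, indic_false by lia; ring. }
      induction n as [|n IH]; simpl; [lra|].
      destruct (Nat.eq_dec n i) as [->|].
      * rewrite E by lia; pose proof (indic_bounds (i = i)); lra.
      * rewrite (indic_false (n = i)) by assumption; lra.
  - apply Rle_trans with (rsum (fun _ => 0) n); [|rewrite rsum_const; lra].
    apply rsum_le; intros i Hi; rewrite indic_false; [lra|]; intros Pi; apply No; eauto.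
Qed.

(** * Expectation over random words *)

(* The newest letter is the head of the word, so that the maps are applied from
   the last letter to the first. *)
Fixpoint expect (p : R) (n : nat) (f : list bool -> R) : R :=
  match n with
  | O => f nil
  | S k => expect p k (fun w => p * f (true :: w) + (1 - p) * f (false :: w))
  end.

Lemma expect_le (p : R) (n : nat) (f g : list bool -> R) :
  0 < p < 1 -> (forall w, length w = n -> f w <= g w) -> expect p n f <= expect p n g.
Proof.
  intros Hp; revert f g; induction n as [|n IH]; simpl; intros f g H; [apply H; reflexivity|].
  apply IH; intros w Hw.
  apply Rplus_le_compat; apply Rmult_le_compat_l; try lra; apply H; simpl; lia.
Qed.

Lemma expect_ext (p : R) (n : nat) (f g : list bool -> R) :
  0 < p < 1 -> (forall w, length w = n -> f w = g w) -> expect p n f = expect p n g.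
Proof.
  intros Hp H; apply Rle_antisym; apply expect_le; try assumption;
    intros w Hw; rewrite H by assumption; lra.
Qed.

Lemma expect_linear (p : R) (n : nat) (a b : R) (f g : list bool -> R) :
  0 < p < 1 ->
  expect p n (fun w => a * f w + b * g w) = a * expect p n f + b * expect p n g.
Proof.
  intros Hp; revert f g; induction n as [|n IH]; simpl; intros f g; [reflexivity|].
  rewrite <- IH; apply expect_ext; [assumption|]; intros; ring.
Qed.

Lemma expect_const (p : R) (n : nat) (c : R) : 0 < p < 1 -> expect p n (fun _ => c) = c.
Proof.
  intros Hp; revert c; induction n as [|n IH]; simpl; intros c; [reflexivity|].
  rewrite IH; ring.
Qed.

Lemma expect_rsum (p : R) (n : nat) (f : nat -> list bool -> R) (m : nat) :
  0 < p < 1 ->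
  expect p n (fun w => rsum (fun i => f i w) m) = rsum (fun i => expect p n (f i)) m.
Proof.
  intros Hp; induction m as [|m IH]; simpl.
  - apply expect_const; assumption.
  - rewrite <- IH.
    transitivity (1 * expect p n (fun w => rsum (fun i => f i w) m) + 1 * expect p n (f m)); [|ring].
    rewrite <- expect_linear by assumption.
    apply expect_ext; [assumption|]; intros; ring.
Qed.

(** Independence of successive letters: [w] is drawn first and [u], which acts after it, has the
    same law whatever [w] is. *)
Lemma expect_app (p : R) (m n : nat) (f : list bool -> R) :
  0 < p < 1 ->
  expect p (m + n) f = expect p n (fun w => expect p m (fun u => f (u ++ w))).
Proof.
  intros Hp; revert f; induction m as [|m IH]; simpl; intros f; [reflexivity|].
  rewrite IH; reflexivity.
Qed.

Lemma cyl_weight_pos (p : R) (w : list bool) : 0 < p < 1 -> 0 < cyl_weight p w.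
Proof.
  intros Hp; induction w as [|[] w IH]; simpl; [lra | |]; apply Rmult_lt_0_compat; lra.
Qed.

Lemma expect_ge_word (p : R) (u : list bool) (f : list bool -> R) :
  0 < p < 1 -> (forall w, 0 <= f w) -> cyl_weight p u * f u <= expect p (length u) f.
Proof.
  intros Hp; revert f; induction u as [|b u IH]; simpl; intros f Hf; [lra|].
  eapply Rle_trans; [|apply IH].
  - pose proof (cyl_weight_pos p u Hp).
    pose proof (Hf (true :: u)); pose proof (Hf (false :: u)).
    rewrite (Rmult_comm _ (cyl_weight p u)), Rmult_assoc.
    apply Rmult_le_compat_l; [lra|].
    destruct b; nra.
  - intros w; pose proof (Hf (true :: w)); pose proof (Hf (false :: w)); nra.
Qed.

(** A bound through the length alone: the merging word varies with the pair of points, its length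
    does not. *)
Lemma cyl_weight_ge (p : R) (w : list bool) :
  0 < p < 1 -> Rmin p (1 - p) ^ length w <= cyl_weight p w.
Proof.
  intros Hp; pose proof (Rmin_l p (1 - p)); pose proof (Rmin_r p (1 - p)).
  assert (0 < Rmin p (1 - p)) by (apply Rmin_glb_lt; lra).
  induction w as [|b w IH]; simpl; [lra|].
  apply Rmult_le_compat; [lra | apply pow_le; lra | destruct b; lra | assumption].
Qed.

(** * Contraction of the number of distinct images *)

(** The number of nonzero index gaps left between [J + 1] consecutive orbit points; one more than
    this bounds the number of distinct images. *)
Definition changes (alpha beta x : R) (J : nat) (w : list bool) : R :=
  rsum (fun j => indic (idx alpha beta w x j <> idx alpha beta w x (S j))) J.

(* Among the gaps of total length at most [J + t], at most [(J + t) / K] exceed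
   [K]; each other nonzero gap closes with probability at least [q]. *)
Lemma changes_contract (alpha beta p : R) (K : nat) :
  0 < alpha < 1 -> irrational alpha -> irrational beta -> 0 < p < 1 -> (0 < K)%nat ->
  exists (q : R) (N : nat), 0 < q <= 1 /\ forall x J t,
    expect p (N + t) (changes alpha beta x J) <=
    (1 - q) * expect p t (changes alpha beta x J) + q * (INR (J + t) / INR K).
Proof.
  intros Ha Hia Hib Hp HK.
  destruct (coalescing_word_uniform alpha beta K Ha Hia Hib) as [N HN].
  pose proof (Rmin_l p (1 - p)); pose proof (Rmin_r p (1 - p)).
  assert (Hmin : 0 < Rmin p (1 - p)) by (apply Rmin_glb_lt; lra).
  set (q := Rmin p (1 - p) ^ N).
  assert (Hq : 0 < q <= 1).
  { split; [apply pow_lt; assumption|].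
    rewrite <- (pow1 N); apply pow_incr; lra. }
  assert (HK' : 0 < INR K) by (apply lt_0_INR; assumption).
  exists q, N; split; [assumption|]; intros x J t.
  rewrite expect_app by assumption.
  rewrite <- (expect_const p t (INR (J + t) / INR K) Hp) at 1.
  rewrite <- expect_linear by assumption.
  apply expect_le; [assumption|]; intros w Hw.
  unfold changes; rewrite expect_rsum by assumption.
  set (g := fun j => idx alpha beta w x j).
  (* Bound gap by gap: a closed gap stays closed; a nonzero gap of at most [K] survives with
     probability at most [1 - q]; for a longer one, [gap / K >= 1] makes the right side at least
     1. *)
  apply Rle_trans with
    (rsum (fun j => (1 - q) * indic (g j <> g (S j)) + q * (INR (g (S j)) - INR (g j)) / INR K) J).
  - apply rsum_le; intros j _.
    set (y := x + INR (length w) * alpha).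
    rewrite (expect_ext _ _ _ (fun u => indic (idx alpha beta u y (g j) <> idx alpha beta u y (g (S j)))))
      by (try assumption; intros; rewrite !idx_app; reflexivity).
    pose proof (idx_mono alpha beta w x j) as Hg; fold (g j) (g (S j)) in Hg.
    assert (Hge : 0 <= (INR (g (S j)) - INR (g j)) / INR K).
    { apply Rmult_le_pos; [apply le_INR in Hg; lra | apply Rlt_le, Rinv_0_lt_compat; assumption]. }
    unfold Rdiv; rewrite Rmult_assoc; fold (Rdiv (INR (g (S j)) - INR (g j)) (INR K)).
    destruct (Nat.eq_dec (g j) (g (S j))) as [E|NE].
    + rewrite E, indic_false by tauto.
      rewrite (expect_ext _ _ _ (fun _ => 0)), expect_const
        by (try assumption; intros; apply indic_false; tauto).
      replace (INR (g (S j)) - INR (g (S j))) with 0 by ring; unfold Rdiv; lra.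
    + rewrite (indic_true (g j <> g (S j))) by assumption.
      destruct (Nat.le_gt_cases (g (S j) - g j) K) as [Hk|Hk].
      * destruct (HN _ y (g j) Hk) as [u [Hu E]].
        replace (g j + (g (S j) - g j))%nat with (g (S j)) in E by lia.
        (* The merging probability is the expectation of the complementary indicator, and the single
           word [u] already contributes at least [q]. *)
        pose proof (expect_ge_word p u
          (fun u => 1 - indic (idx alpha beta u y (g j) <> idx alpha beta u y (g (S j)))) Hp) as Hlow.
        cbv beta in Hlow; rewrite indic_false, Hu in Hlow by (rewrite E; tauto).
        rewrite (expect_ext _ _ _ (fun u => 1 * (fun _ => 1) u + (-1) * indic (idx alpha beta u y (g j) <> idx alpha beta u y (g (S j)))))
          in Hlow by (try assumption; intros; ring).
        rewrite expect_linear, expect_const in Hlow by assumption.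
        pose proof (cyl_weight_ge p u Hp) as Hc; rewrite Hu in Hc; fold q in Hc.
        assert (0 <= q * ((INR (g (S j)) - INR (g j)) / INR K)) by (apply Rmult_le_pos; lra).
        assert (Hpos : forall w0, 0 <= 1 - indic (idx alpha beta w0 y (g j) <> idx alpha beta w0 y (g (S j))))
          by (intros v; pose proof (indic_bounds (idx alpha beta v y (g j) <> idx alpha beta v y (g (S j)))); lra).
        specialize (Hlow Hpos); lra.
      * apply Rle_trans with 1.
        { rewrite <- (expect_const p N 1 Hp); apply expect_le; [assumption|].
          intros; apply indic_bounds. }
        assert (1 <= (INR (g (S j)) - INR (g j)) / INR K); [|nra].
        apply Rmult_le_reg_r with (INR K); [assumption|].
        unfold Rdiv; rewrite Rmult_assoc, Rinv_l, Rmult_1_r by lra.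
        apply Nat.lt_le_incl, le_INR in Hk; rewrite minus_INR in Hk by lia; lra.
  (* The gaps telescope to [g J - g 0], at most [J + t]. *)
  - rewrite rsum_plus, rsum_scal; fold g; apply Rplus_le_compat_l.
    rewrite (rsum_ext _ (fun j => q / INR K * ((fun j => INR (g j)) (S j) - (fun j => INR (g j)) j)))
      by (intros; unfold Rdiv; ring).
    rewrite rsum_scal, (rsum_telescope (fun j => INR (g j))).
    pose proof (idx_le alpha beta w x J) as Hl; fold (g J) in Hl; rewrite Hw in Hl.
    apply le_INR in Hl; pose proof (pos_INR (g 0%nat)).
    replace (q * (INR (J + t) / INR K)) with (q / INR K * INR (J + t)) by (unfold Rdiv; ring).
    apply Rmult_le_compat_l; [|lra].
    apply Rmult_le_pos; [lra | apply Rlt_le, Rinv_0_lt_compat; assumption].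
Qed.

(** Each block of [N] letters averages the old bound with [INR (J + t) / INR K], weights [1 - q] and
    [q]. That term is nondecreasing in [t], so its latest value dominates the accumulated error. *)
Lemma changes_iterate (alpha beta p : R) (K : nat) :
  0 < alpha < 1 -> irrational alpha -> irrational beta -> 0 < p < 1 -> (0 < K)%nat ->
  exists (q : R) (N : nat), 0 < q <= 1 /\ forall x J s,
    expect p (s * N) (changes alpha beta x J) <=
    (1 - q) ^ s * INR J + INR (J + s * N) / INR K.
Proof.
  intros Ha Hia Hib Hp HK.
  destruct (changes_contract alpha beta p K Ha Hia Hib Hp HK) as [q [N [Hq HN]]].
  assert (HK' : 0 < / INR K) by (apply Rinv_0_lt_compat, lt_0_INR; assumption).
  exists q, N; split; [assumption|]; intros x J s; induction s as [|s IH].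
  - simpl; unfold changes; rewrite Nat.add_0_r.
    assert (rsum (fun j => indic (idx alpha beta nil x j <> idx alpha beta nil x (S j))) J <= INR J).
    { rewrite <- (Rmult_1_r (INR J)), <- rsum_const; apply rsum_le; intros; apply indic_bounds. }
    pose proof (pos_INR J); unfold Rdiv; nra.
  - cbn [Nat.mul pow]; eapply Rle_trans; [apply HN|].
    assert (INR (J + s * N) / INR K <= INR (J + (N + s * N)) / INR K).
    { apply Rmult_le_compat_r; [lra | apply le_INR; lia]. }
    nra.
Qed.

(** * Counting orbit points in the image *)

Definition img (alpha beta : R) (w : list bool) (x : R) : Prop :=
  exists y, 0 <= y < 1 /\ x = act alpha beta w y.

Lemma Tsel_preimage (alpha beta : R) (b : bool) (y z : R) :
  0 <= y < 1 -> Tsel alpha beta b y = mod1 z ->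
  y = mod1 (z - alpha) \/ y = mod1 (z - alpha - beta).
Proof.
  intros Hy E; rewrite <- (mod1_id y) by assumption.
  assert (H : mod1 (y + alpha) = mod1 z \/ mod1 (y + alpha + beta) = mod1 z).
  { unfold Tsel, T1, T2 in E; destruct b; [|destruct Rle_dec]; tauto. }
  destruct H as [H|H]; destruct (mod1_eq _ _ H) as [k Hk]; [left | right];
    apply (mod1_shift _ _ k); lra.
Qed.

(** Each letter undone subtracts [alpha] and possibly [beta], so the index falls by at most
    [length w] and stays a natural number. *)
Lemma act_preimage_orbit (alpha beta : R) (w : list bool) (x y : R) (m : nat) :
  0 <= y < 1 -> (length w <= m)%nat ->
  act alpha beta w y = mod1 (x + INR (length w) * alpha + INR m * beta) ->
  exists j, (j <= m)%nat /\ y = mod1 (x + INR j * beta).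
Proof.
  intros Hy; revert m; induction w as [|b w IH]; intros m Hm E.
  - exists m; split; [lia|].
    simpl in E; rewrite E; f_equal; ring.
  - cbn [act length] in *; rewrite S_INR in E.
    apply Tsel_preimage in E; [|apply act_bounds; assumption].
    destruct E as [E|E].
    + apply IH; [lia | rewrite E; f_equal; ring].
    + destruct (IH (m - 1)%nat) as [j [Hj Ej]]; [lia | | exists j; split; [lia | assumption]].
      rewrite E, minus_INR by lia; f_equal; simpl; ring.
Qed.

(** By induction on [J]: a value not seen before can only appear at a change. *)
Lemma values_le_changes (g : nat -> nat) (c M J : nat) :
  rsum (fun v => indic (exists j, (j <= J)%nat /\ g j = (c + v)%nat)) M <=
  1 + rsum (fun j => indic (g j <> g (S j))) J.
Proof.
  induction J as [|J IH].
  - simpl; rewrite Rplus_0_r; apply rsum_indic_unique.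
    intros v v' [j [Hj E]] [j' [Hj' E']].
    replace j with 0%nat in E by lia; replace j' with 0%nat in E' by lia; lia.
  - cbn [rsum]; rewrite <- Rplus_assoc.
    destruct (Nat.eq_dec (g J) (g (S J))) as [E|NE].
    + apply Rle_trans with (2 := Rplus_le_compat _ _ _ _ IH (proj1 (indic_bounds _))).
      rewrite Rplus_0_r; apply rsum_le; intros v _; apply indic_mono.
      intros [j [Hj Ej]]; destruct (Nat.eq_dec j (S J)) as [->|].
      * exists J; split; [lia | congruence].
      * exists j; split; [lia | assumption].
    + rewrite (indic_true (g J <> g (S J))) by assumption.
      apply Rle_trans with (rsum (fun v => indic (exists j, (j <= J)%nat /\ g j = (c + v)%nat)
                                         + indic (g (S J) = (c + v)%nat)) M).
      * apply rsum_le; intros v _; apply indic_le.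
        { pose proof (indic_bounds (exists j, (j <= J)%nat /\ g j = (c + v)%nat)).
          pose proof (indic_bounds (g (S J) = (c + v)%nat)); lra. }
        intros [j [Hj Ej]]; destruct (Nat.eq_dec j (S J)) as [->|].
        -- rewrite (indic_true (g (S J) = _)) by assumption.
           pose proof (indic_bounds (exists j, (j <= J)%nat /\ g j = (c + v)%nat)); lra.
        -- rewrite indic_true by (exists j; split; [lia | assumption]).
           pose proof (indic_bounds (g (S J) = (c + v)%nat)); lra.
      * rewrite rsum_plus; apply Rplus_le_compat; [assumption|].
        apply rsum_indic_unique; intros; lia.
Qed.

(** The base point is [z] moved back by [n * (alpha + beta)], so that [z + m * beta] gets index
    [n + m >= n] and its preimages have indices between 0 and [n + m]. Irrationality of [beta] makes
    the index of an orbit point unique. *)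
Lemma orbit_points_le_changes (alpha beta : R) (w : list bool) (z : R) (M : nat) :
  irrational beta ->
  rsum (fun m => indic (img alpha beta w (mod1 (z + INR m * beta)))) M <=
  1 + changes alpha beta (z - INR (length w) * (alpha + beta)) (M + length w) w.
Proof.
  intros Hb; set (n := length w); set (x := z - INR n * (alpha + beta)).
  eapply Rle_trans; [|apply (values_le_changes (idx alpha beta w x) n)].
  apply rsum_le; intros m Hm; apply indic_mono.
  intros [y [Hy E]]; symmetry in E.
  replace (z + INR m * beta) with (x + INR n * alpha + INR (n + m) * beta) in E
    by (unfold x; rewrite plus_INR; ring).
  apply act_preimage_orbit in E as Ej; [|assumption | fold n; lia].
  destruct Ej as [j [Hj Ey]].
  exists j; split; [lia|].
  rewrite Ey, act_orbit in E; fold n in E.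
  destruct (mod1_eq _ _ E) as [k Hk].
  assert (Z.of_nat (idx alpha beta w x j) - Z.of_nat (n + m) = 0)%Z; [|lia].
  apply (irrational_mult beta _ k Hb).
  rewrite minus_IZR, <- !INR_IZR_INZ; lra.
Qed.

(** * Images as finite unions of intervals *)

(** Encodes a finite union of intervals and points of [[0,1)] by break points: membership can change
    only at a point of [D]. *)
Definition constant_off (D : list R) (U : R -> Prop) : Prop :=
  forall x y, 0 <= x -> x <= y -> y < 1 ->
    (forall d, In d D -> ~ (x <= d <= y)) -> (U x <-> U y).

Lemma constant_off_and (D E : list R) (U V : R -> Prop) :
  constant_off D U -> constant_off E V -> constant_off (D ++ E) (fun x => U x /\ V x).
Proof.
  intros HD HE x y Hx Hxy Hy H.
  rewrite (HD x y), (HE x y); try assumption; [tauto | |];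
    intros d Hd; apply H, in_or_app; tauto.
Qed.

Lemma constant_off_or (D E : list R) (U V : R -> Prop) :
  constant_off D U -> constant_off E V -> constant_off (D ++ E) (fun x => U x \/ V x).
Proof.
  intros HD HE x y Hx Hxy Hy H.
  rewrite (HD x y), (HE x y); try assumption; [tauto | |];
    intros d Hd; apply H, in_or_app; tauto.
Qed.

(** The extra break [mod1 c] is the point rotated onto 0, where the circle is cut open. *)
Lemma constant_off_rotate (c : R) (D : list R) (U : R -> Prop) :
  constant_off D U ->
  constant_off (mod1 c :: map (fun d => mod1 (d + c)) D) (fun x => U (mod1 (x - c))).
Proof.
  intros HD x y Hx Hxy Hy H.
  destruct (mod1_decomp c) as [k Hk]; pose proof (mod1_bounds c).
  assert (Hc := H _ (or_introl eq_refl)).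
  (* Since [mod1 c] does not separate [x] from [y], the same integer [s] brings both back into
     [[0,1)]. *)
  assert (Hs : exists s : Z, 0 <= x - mod1 c + IZR s /\ y - mod1 c + IZR s < 1).
  { destruct (Rle_dec x (mod1 c)); [exists 1%Z | exists 0%Z]; lra. }
  destruct Hs as [s [Hs1 Hs2]].
  rewrite (mod1_unique (x - c) (x - mod1 c + IZR s) (- k - s)), (mod1_unique (y - c) (y - mod1 c + IZR s) (- k - s));
    try lra; try (rewrite minus_IZR, opp_IZR; lra).
  apply HD; try lra; intros d Hd Hd'.
  apply (H (mod1 (d + c))); [right; apply (in_map (fun d => mod1 (d + c))); assumption|].
  rewrite (mod1_unique (d + c) (d + mod1 c - IZR s) (k + s)); [lra | lra | rewrite plus_IZR; lra].
Qed.

Lemma constant_off_le (t : R) : constant_off (t :: nil) (fun x => x <= t).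
Proof. intros x y Hx Hxy Hy H; assert (Ht := H t (or_introl eq_refl)); lra. Qed.

Lemma constant_off_gt (t : R) : constant_off (t :: nil) (fun x => t < x).
Proof. intros x y Hx Hxy Hy H; assert (Ht := H t (or_introl eq_refl)); lra. Qed.

Lemma constant_off_ext (D : list R) (U V : R -> Prop) :
  (forall x, 0 <= x < 1 -> (U x <-> V x)) -> constant_off D U -> constant_off D V.
Proof.
  intros E HD x y Hx Hxy Hy H; rewrite <- !E by lra; apply HD; assumption.
Qed.

(** Here and for [T2], the image is rewritten through inverse rotations, the form to which the
    closure properties of [constant_off] apply. *)
Lemma T1_image (alpha : R) (U : R -> Prop) (x : R) :
  (forall y, U y -> 0 <= y < 1) -> 0 <= x < 1 ->
  (U (mod1 (x - alpha)) <-> exists y, U y /\ x = T1 alpha y).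
Proof.
  intros HU Hx; unfold T1; split.
  - intros H; exists (mod1 (x - alpha)); split; [assumption|].
    rewrite mod1_plus_mod1, <- (mod1_id x) at 1 by assumption; f_equal; ring.
  - intros [y [Hy E]]; rewrite E; unfold Rminus; rewrite mod1_plus_mod1.
    replace (y + alpha + - alpha) with y by ring; rewrite mod1_id; auto.
Qed.

Lemma T2_image (alpha beta : R) (U : R -> Prop) (x : R) :
  (forall y, U y -> 0 <= y < 1) -> 0 <= x < 1 ->
  ((U (mod1 (x - (alpha + beta))) /\ mod1 (x - (alpha + beta)) <= 1 - alpha \/
    U (mod1 (x - alpha)) /\ 1 - alpha < mod1 (x - alpha))
   <-> exists y, U y /\ x = T2 alpha beta y).
Proof.
  intros HU Hx; unfold T2; split.
  - intros [[H Hl]|[H Hl]]; eexists; (split; [exact H|]); destruct Rle_dec; try lra;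
      rewrite ?Rplus_assoc, mod1_plus_mod1, <- (mod1_id x) at 1 by assumption; f_equal; ring.
  - intros [y [Hy E]]; specialize (HU y Hy).
    destruct (Rle_dec y (1 - alpha)); [left | right].
    + replace (mod1 (x - (alpha + beta))) with y; [tauto|].
      rewrite E; unfold Rminus; rewrite mod1_plus_mod1.
      rewrite <- (mod1_id y) at 1 by assumption; f_equal; ring.
    + replace (mod1 (x - alpha)) with y; [split; [tauto | lra]|].
      rewrite E; unfold Rminus; rewrite mod1_plus_mod1.
      rewrite <- (mod1_id y) at 1 by assumption; f_equal; ring.
Qed.

(** [T_2] cuts the set at [1 - alpha] and rotates the two pieces: each of the two lists gains the
    cut and the rotation break, giving [2 * (k + 2)] from [k] breaks. *)
Fixpoint max_breaks (n : nat) : nat :=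
  match n with O => 0 | S k => 2 * max_breaks k + 4 end.

Lemma img_bounds (alpha beta : R) (w : list bool) (x : R) : img alpha beta w x -> 0 <= x < 1.
Proof. intros [y [Hy ->]]; apply act_bounds; assumption. Qed.

Lemma img_cons (alpha beta : R) (b : bool) (w : list bool) (x : R) :
  (exists y, img alpha beta w y /\ x = Tsel alpha beta b y) <-> img alpha beta (b :: w) x.
Proof.
  split.
  - intros [y [[z [Hz ->]] ->]]; exists z; split; [assumption | reflexivity].
  - intros [z [Hz ->]]; exists (act alpha beta w z); split; [exists z; tauto | reflexivity].
Qed.

Lemma img_constant_off (alpha beta : R) (w : list bool) :
  exists D, (length D <= max_breaks (length w))%nat /\ constant_off D (img alpha beta w).
Proof.
  induction w as [|b w [D [HD HU]]].
  - exists nil; split; [simpl; lia|].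
    apply (constant_off_ext _ (fun _ => True)); [|intros x y; tauto].
    intros x Hx; split; [intros _; exists x; split; [assumption | reflexivity] | tauto].
  - pose proof (img_bounds alpha beta w) as Hb.
    destruct b.
    + exists (mod1 alpha :: map (fun d => mod1 (d + alpha)) D); split.
      * simpl; rewrite length_map; lia.
      * apply (constant_off_ext _ (fun x => img alpha beta w (mod1 (x - alpha)))).
        -- intros x Hx; rewrite <- img_cons; apply T1_image; assumption.
        -- apply constant_off_rotate; assumption.
    (* The closure lemmas determine the break list; its length is counted afterwards. *)
    + eexists; split; cycle 1.
      * eapply constant_off_ext.
        { intros x Hx; eapply iff_trans; [|apply img_cons].
          exact (T2_image alpha beta (img alpha beta w) x Hb Hx). }
        apply constant_off_or.
        -- apply (constant_off_rotate (alpha + beta) (D ++ (1 - alpha) :: nil)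
             (fun y => img alpha beta w y /\ y <= 1 - alpha)).
           apply constant_off_and; [exact HU | apply constant_off_le].
        -- apply (constant_off_rotate alpha (D ++ (1 - alpha) :: nil)
             (fun y => img alpha beta w y /\ 1 - alpha < y)).
           apply constant_off_and; [exact HU | apply constant_off_gt].
      * simpl; rewrite length_app; simpl; rewrite !length_map, !length_app; simpl; lia.
Qed.

(** * Covering images by grid cells *)

Definition cell (L i : nat) (z : R) : Prop := INR i <= INR L * z < INR i + 1.

(** The number of cells of length [1 / L] that meet [U]; divided by [L] it bounds the outer
    measure. *)
Definition cover (L : nat) (U : R -> Prop) : R :=
  rsum (fun i => indic (exists z, cell L i z /\ U z)) L.

Lemma cell_unique (L i j : nat) (z : R) : cell L i z -> cell L j z -> i = j.
Proof.
  unfold cell; intros H1 H2.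
  assert (i < S j)%nat by (apply INR_lt; rewrite S_INR; lra).
  assert (j < S i)%nat by (apply INR_lt; rewrite S_INR; lra).
  lia.
Qed.

Lemma cell_exists (L : nat) (z : R) : (0 < L)%nat -> 0 <= z < 1 -> exists i, (i < L)%nat /\ cell L i z.
Proof.
  intros HL Hz; apply lt_0_INR in HL.
  assert (H0 : 0 <= INR L * z) by nra.
  destruct (base_Int_part (INR L * z)) as [H1 H2].
  assert (H3 : (0 <= Int_part (INR L * z))%Z).
  { assert (-1 < Int_part (INR L * z))%Z by (apply lt_IZR; lra). lia. }
  exists (Z.to_nat (Int_part (INR L * z))).
  assert (E : INR (Z.to_nat (Int_part (INR L * z))) = IZR (Int_part (INR L * z)))
    by (rewrite INR_IZR_INZ, Z2Nat.id by assumption; reflexivity).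
  split; [apply INR_lt; rewrite E; nra | unfold cell; rewrite E; lra].
Qed.

Lemma cells_meeting_list (L : nat) (D : list R) (n : nat) :
  rsum (fun i => indic (exists d, In d D /\ cell L i d)) n <= INR (length D).
Proof.
  induction D as [|d D IH].
  - apply Rle_trans with (rsum (fun _ => 0) n); [|rewrite rsum_const; simpl; lra].
    apply rsum_le; intros i _; rewrite indic_false; [lra|]; intros [d [[] _]].
  - cbn [length]; rewrite S_INR.
    apply Rle_trans with (rsum (fun i => indic (exists d, In d D /\ cell L i d) + indic (cell L i d)) n).
    + apply rsum_le; intros i _; apply indic_le.
      * pose proof (indic_bounds (exists d, In d D /\ cell L i d)); pose proof (indic_bounds (cell L i d)); lra.
      * intros [e [[<-|He] Hc]].
        -- rewrite (indic_true (cell L i d)) by assumption.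
           pose proof (indic_bounds (exists d, In d D /\ cell L i d)); lra.
        -- rewrite indic_true by eauto; pose proof (indic_bounds (cell L i d)); lra.
    + rewrite rsum_plus; apply Rplus_le_compat; [assumption|].
      apply rsum_indic_unique; intros i j; apply cell_unique.
Qed.

Lemma rotated_grid_meets_cell (L c : nat) (t : R) :
  (c < L)%nat -> exists i, (i < L)%nat /\ cell L c (mod1 (INR i / INR L + t)).
Proof.
  intros Hc; assert (HL : 0 < INR L) by (apply lt_0_INR; lia).
  (* The integer shift with [INR L * t + z] in [[c, c + 1)]; its residue modulo [L] is the grid
     index. *)
  set (z := (- Int_part (INR L * t - INR c))%Z).
  destruct (base_Int_part (INR L * t - INR c)) as [H1 H2].
  assert (Hz : 0 <= INR L * t - INR c + IZR z < 1) by (unfold z; rewrite opp_IZR; lra).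
  set (l := Z.of_nat L).
  assert (Hl : INR L = IZR l) by apply INR_IZR_INZ.
  pose proof (Z.mod_pos_bound z l ltac:(lia)); pose proof (Z.div_mod z l ltac:(lia)) as Hdm.
  exists (Z.to_nat (z mod l)); split; [lia|].
  rewrite (INR_IZR_INZ (Z.to_nat _)), Z2Nat.id by lia.
  assert (Hzr : IZR z = INR L * IZR (z / l) + IZR (z mod l))
    by (rewrite Hl, <- mult_IZR, <- plus_IZR; f_equal; assumption).
  assert (Hc' : INR c + 1 <= INR L) by (rewrite <- S_INR; apply le_INR; lia).
  pose proof (pos_INR c).
  set (v := IZR (z mod l) / INR L + t + IZR (z / l)).
  assert (Hv : INR L * v = INR L * t + IZR z) by (unfold v; rewrite Hzr; field; lra).
  rewrite (mod1_unique _ v (- (z / l))).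
  - unfold cell; lra.
  - split; nra.
  - rewrite opp_IZR; unfold v; ring.
Qed.

(** A cell without breaks that meets [U] has all its points of [[0,1)] in [U], among them a rotated
    grid point; at most [length D] cells contain a break. *)
Lemma cover_le_rotated_grid (L : nat) (D : list R) (U : R -> Prop) (t : R) :
  (forall z, U z -> 0 <= z < 1) -> constant_off D U ->
  cover L U <= rsum (fun i => indic (U (mod1 (INR i / INR L + t)))) L + INR (length D).
Proof.
  intros HU HD; set (pt := fun i => mod1 (INR i / INR L + t)).
  apply Rle_trans with (rsum (fun c => rsum (fun i => indic (cell L c (pt i) /\ U (pt i))) L
                                     + indic (exists d, In d D /\ cell L c d)) L).
  - apply rsum_le; intros c Hc; apply indic_le.
    + apply Rplus_le_le_0_compat; [apply rsum_nonneg; intros|]; apply indic_bounds.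
    + intros [z [Hz Uz]].
      destruct (classic (exists d, In d D /\ cell L c d)) as [Hd|Hd].
      * rewrite (indic_true (exists d, _)) by assumption.
        enough (0 <= rsum (fun i => indic (cell L c (pt i) /\ U (pt i))) L) by lra.
        apply rsum_nonneg; intros; apply indic_bounds.
      * rewrite (indic_false (exists d, _)) by assumption; rewrite Rplus_0_r.
        destruct (rotated_grid_meets_cell L c t Hc) as [i [Hi Hci]]; fold (pt i) in Hci.
        rewrite <- (indic_true (cell L c (pt i) /\ U (pt i))).
        { apply (rsum_ge_term (fun i => indic (cell L c (pt i) /\ U (pt i))));
            [intros; apply indic_bounds | assumption]. }
        split; [assumption|].
        assert (HL : 0 < INR L) by (apply lt_0_INR; lia).
        pose proof (HU z Uz); pose proof (mod1_bounds (INR i / INR L + t)) as Hpt; fold (pt i) in Hpt.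
        assert (No : forall a b d, cell L c a -> cell L c b -> In d D -> ~ (a <= d <= b)).
        { unfold cell; intros a b d Ha Hb Hin Hab; apply Hd; exists d; split; [assumption|].
          unfold cell; split; nra. }
        destruct (Rle_dec z (pt i)).
        -- apply (HD z (pt i)); try lra; try assumption; intros d Hin; apply No; assumption.
        -- apply (HD (pt i) z); try lra; try assumption; intros d Hin; apply No; assumption.
  - rewrite rsum_plus; apply Rplus_le_compat; [|apply cells_meeting_list].
    (* Each grid point is counted in one cell at most. *)
    rewrite rsum_swap; apply rsum_le; intros i _.
    apply Rle_trans with (rsum (fun c => indic (U (pt i)) * indic (cell L c (pt i))) L).
    + apply rsum_le; intros c _; apply indic_le.
      * apply Rmult_le_pos; apply indic_bounds.
      * intros [H1 H2]; rewrite !indic_true by assumption; lra.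
    + rewrite rsum_scal, <- (Rmult_1_r (indic (U (mod1 _)))).
      apply Rmult_le_compat_l; [apply indic_bounds|].
      apply rsum_indic_unique; intros a b; apply cell_unique.
Qed.

(** The grid is rotated by [m * beta] for each [m < M]. Summing over [m] first groups the rotated
    points into the [beta]-orbits of the grid points. *)
Lemma cover_le_orbits (alpha beta : R) (L M : nat) (w : list bool) :
  irrational beta ->
  INR M * cover L (img alpha beta w) <=
  rsum (fun i => 1 + changes alpha beta (INR i / INR L - INR (length w) * (alpha + beta))
                       (M + length w) w) L
  + INR M * INR (max_breaks (length w)).
Proof.
  intros Hb; destruct (img_constant_off alpha beta w) as [D [HD HU]].
  rewrite <- (rsum_const (cover _ _)), <- (rsum_const (INR (max_breaks _))).
  apply Rle_trans with (rsum (fun m =>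
    rsum (fun i => indic (img alpha beta w (mod1 (INR i / INR L + INR m * beta)))) L
    + INR (max_breaks (length w))) M).
  - apply rsum_le; intros m _; eapply Rle_trans.
    + apply (cover_le_rotated_grid L D _ (INR m * beta)); [apply img_bounds | assumption].
    + apply Rplus_le_compat_l, le_INR; assumption.
  - rewrite rsum_plus; apply Rplus_le_compat_r; rewrite rsum_swap.
    apply rsum_le; intros i _; apply orbit_points_le_changes; assumption.
Qed.

Lemma leb_outer_lt_cover (L : nat) (U : R -> Prop) (eps : R) :
  (0 < L)%nat -> (forall z, U z -> 0 <= z < 1) -> cover L U < eps * INR L -> leb_outer_lt U eps.
Proof.
  intros HL HU H; assert (HL' : 0 < INR L) by (apply lt_0_INR; assumption).
  (* Lengths of the covering intervals: [1 / L] for a cell that is met, 0 for the others and for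
     every index from [L] on. *)
  set (f := fun i => if (i <? L)%nat then indic (exists z, cell L i z /\ U z) / INR L else 0).
  assert (Hf : forall i, 0 <= f i).
  { intros i; unfold f; destruct (i <? L)%nat; [|lra].
    apply Rmult_le_pos; [apply indic_bounds | apply Rlt_le, Rinv_0_lt_compat; assumption]. }
  exists (fun i => INR i / INR L), (fun i => INR i / INR L + f i), (cover L U / INR L).
  split; [|split; [|split]].
  - intros i; specialize (Hf i); lra.
  - intros x Ux; destruct (cell_exists L x HL (HU x Ux)) as [i [Hi Hc]]; exists i.
    unfold f; apply Nat.ltb_lt in Hi as ->; rewrite indic_true by eauto.
    destruct Hc as [H1 H2]; split; apply Rmult_le_reg_l with (INR L); try assumption; field_simplify; lra.
  - intros N; apply Rle_trans with (rsum f (S N)).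
    { apply Req_le; induction N as [|N IH]; simpl; [|rewrite IH; simpl]; ring. }
    assert (HfL : rsum f L = cover L U / INR L).
    { unfold cover, Rdiv; rewrite Rmult_comm, <- rsum_scal; apply rsum_ext.
      intros i Hi; unfold f; apply Nat.ltb_lt in Hi as ->; unfold Rdiv; ring. }
    rewrite <- HfL; clear - Hf.
    assert (Hmono : forall m n, (m <= n)%nat -> rsum f m <= rsum f n).
    { intros m n Hmn; induction Hmn; simpl; [lra | pose proof (Hf m0); lra]. }
    destruct (Nat.le_gt_cases (S N) L) as [Hl|Hl]; [apply Hmono; assumption|].
    assert (E : forall d, rsum f (d + L) = rsum f L).
    { induction d as [|d IH]; simpl; [reflexivity|].
      rewrite IH; unfold f at 2.
      replace (d + L <? L)%nat with false by (symmetry; apply Nat.ltb_ge; lia); ring. }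
    replace (S N) with (S N - L + L)%nat by lia; rewrite E; lra.
  - apply Rmult_lt_reg_r with (INR L); [assumption|].
    unfold Rdiv; rewrite Rmult_assoc, Rinv_l by lra; lra.
Qed.

Lemma Rdiv_le_of_le_mult (a b c : R) : 0 < b -> a <= c * b -> a / b <= c.
Proof.
  intros Hb H; apply Rmult_le_reg_r with b; [assumption|].
  unfold Rdiv; rewrite Rmult_assoc, Rinv_l by lra; lra.
Qed.

(** * Smallness of the expected measure *)

(** Divided by [M * L], the bound has four terms: [1 / M], [(1 - q)^s * (M + n) / M],
    [(M + 2 * n) / (K * M)] and [max_breaks n / L]. Choosing [K], [s], [M], [L] in this order makes
    each at most [c / 4]. *)
Lemma expected_cover_small (alpha beta p c : R) :
  0 < alpha < 1 -> irrational alpha -> irrational beta -> 0 < p < 1 -> 0 < c ->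
  exists n L, (0 < L)%nat /\
    expect p n (fun w => cover L (img alpha beta w)) <= c * INR L.
Proof.
  intros Ha Hia Hib Hp Hc.
  destruct (INR_unbounded (8 / c)) as [K0 HK0]; set (K := S K0).
  assert (HK : 8 <= c * INR K).
  { unfold K; rewrite S_INR.
    assert (E : 8 / c * c = 8) by (field; lra). nra. }
  destruct (changes_iterate alpha beta p K Ha Hia Hib Hp ltac:(unfold K; lia)) as [q [N [Hq HN]]].
  destruct (pow_lt_1_zero (1 - q) ltac:(rewrite Rabs_pos_eq; lra) (c / 8) ltac:(lra)) as [s Hs].
  specialize (Hs s (Nat.le_refl s)); rewrite Rabs_pos_eq in Hs by (apply pow_le; lra).
  set (n := (s * N)%nat).
  destruct (INR_unbounded (4 / c)) as [M0 HM0]; set (M := (M0 + 2 * n)%nat).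
  destruct (INR_unbounded (4 * INR (max_breaks n) / c)) as [L0 HL0]; set (L := S L0).
  exists n, L; split; [unfold L; lia|].
  assert (HcM : 4 <= c * INR M).
  { unfold M; rewrite plus_INR; pose proof (pos_INR (2 * n)).
    assert (E : 4 / c * c = 4) by (field; lra). nra. }
  assert (HnM : 2 * INR n <= INR M).
  { unfold M; rewrite plus_INR, mult_INR; pose proof (pos_INR M0); simpl (INR 2); lra. }
  assert (HcL : 4 * INR (max_breaks n) <= c * INR L).
  { unfold L; rewrite S_INR.
    assert (E : 4 * INR (max_breaks n) / c * c = 4 * INR (max_breaks n)) by (field; lra). nra. }
  pose proof (pos_INR n).
  assert (HM : 0 < INR M) by nra.
  assert (HL : 0 < INR L) by (apply lt_0_INR; unfold L; lia).
  assert (HK' : 0 < INR K) by (apply lt_0_INR; unfold K; lia).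
  apply Rmult_le_reg_l with (INR M); [assumption|].
  set (ch := fun i w => 1 + changes alpha beta (INR i / INR L - INR n * (alpha + beta)) (M + n) w).
  apply Rle_trans with (rsum (fun i => expect p n (ch i)) L + INR M * INR (max_breaks n)).
  - rewrite <- expect_rsum by assumption.
    rewrite <- (expect_const p n (INR (max_breaks n)) Hp) at 1.
    (* A zero term is added to match the two-term form of [expect_linear]. *)
    replace (INR M * expect p n (fun w => cover L (img alpha beta w)))
      with (INR M * expect p n (fun w => cover L (img alpha beta w)) + 0 * expect p n (fun _ => 0)) by ring.
    rewrite <- (Rmult_1_l (expect p n (fun w => rsum _ L))).
    rewrite <- !expect_linear by assumption.
    apply expect_le; [assumption|]; intros w Hw.
    pose proof (cover_le_orbits alpha beta L M w Hib) as H'; rewrite Hw in H'.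
    unfold ch; lra.
  - assert (Hch : forall i, expect p n (ch i) <= 3 * (c / 4) * INR M).
    { intros i; unfold ch.
      rewrite (expect_ext _ _ _ (fun w => 1 * (fun _ => 1) w + 1 * changes alpha beta (INR i / INR L - INR n * (alpha + beta)) (M + n) w))
        by (try assumption; intros; ring).
      rewrite expect_linear, expect_const by assumption.
      pose proof (HN (INR i / INR L - INR n * (alpha + beta)) (M + n)%nat s) as H1; fold n in H1.
      rewrite !plus_INR in H1.
      assert ((INR M + INR n + INR n) / INR K <= c / 4 * INR M).
      { apply Rdiv_le_of_le_mult; [assumption|]; nra. }
      assert ((1 - q) ^ s * (INR M + INR n) <= c / 4 * INR M).
      { assert (0 <= (1 - q) ^ s) by (apply pow_le; lra). nra. }
      lra. }
    assert (rsum (fun i => expect p n (ch i)) L <= INR L * (3 * (c / 4) * INR M)).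
    { rewrite <- rsum_const; apply rsum_le; intros; apply Hch. }
    nra.
Qed.

(** Markov's inequality, from an expected cover of at most [eta * eta * INR L]. *)
Lemma expected_bad_small (alpha beta p eta : R) :
  0 < alpha < 1 -> irrational alpha -> irrational beta -> 0 < p < 1 -> 0 < eta ->
  exists n, expect p n (fun w => indic (~ leb_outer_lt (img alpha beta w) eta)) <= eta.
Proof.
  intros Ha Hia Hib Hp He.
  destruct (expected_cover_small alpha beta p (eta * eta) Ha Hia Hib Hp ltac:(nra))
    as [n [L [HL H]]]; exists n.
  assert (HL' : 0 < INR L) by (apply lt_0_INR; assumption).
  assert (HeL : 0 < eta * INR L) by nra.
  apply Rmult_le_reg_l with (eta * INR L); [assumption|].
  replace (eta * INR L * eta) with (eta * eta * INR L) by ring.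
  eapply Rle_trans; [|exact H].
  replace (eta * INR L * expect p n (fun w => indic (~ leb_outer_lt (img alpha beta w) eta)))
    with (eta * INR L * expect p n (fun w => indic (~ leb_outer_lt (img alpha beta w) eta))
          + 0 * expect p n (fun _ => 0)) by ring.
  rewrite <- expect_linear by assumption.
  apply expect_le; [assumption|]; intros w _.
  rewrite Rmult_0_l, Rplus_0_r.
  unfold indic; destruct excluded_middle_informative as [Hbad|_].
  - rewrite Rmult_1_r; apply Rnot_lt_le; intros Hlt; apply Hbad.
    apply (leb_outer_lt_cover L); [assumption | apply img_bounds | assumption].
  - rewrite Rmult_0_r; apply rsum_nonneg; intros; apply indic_bounds.
Qed.

(** * Null sets from lists of cylinders *)

Definition lsum {A : Type} (f : A -> R) (l : list A) : R :=
  fold_right (fun a s => f a + s) 0 l.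

Lemma lsum_app {A : Type} (f : A -> R) (l m : list A) : lsum f (l ++ m) = lsum f l + lsum f m.
Proof. unfold lsum; induction l as [|a l IH]; simpl; [|rewrite IH]; ring. Qed.

Lemma rsum_nth_le_lsum {A : Type} (f : A -> R) (l : list A) (d : A) (n : nat) :
  (forall a, 0 <= f a) -> (n <= length l)%nat -> rsum (fun i => f (nth i l d)) n <= lsum f l.
Proof.
  intros H; revert n; induction l as [|a l IH] using rev_ind; intros n Hn.
  - simpl in Hn; replace n with 0%nat by lia; simpl; lra.
  - rewrite lsum_app; simpl; rewrite length_app in Hn; simpl in Hn.
    assert (Hm : forall m, (m <= length l)%nat -> rsum (fun i => f (nth i (l ++ a :: nil) d)) m <= lsum f l).
    { intros m Hm; rewrite (rsum_ext _ (fun i => f (nth i l d))); [apply IH; assumption|].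
      intros i Hi; rewrite app_nth1 by lia; reflexivity. }
    pose proof (H a).
    destruct (Nat.eq_dec n (S (length l))) as [->|].
    + simpl; rewrite app_nth2, Nat.sub_diag by lia; simpl.
      pose proof (Hm _ (Nat.le_refl _)); lra.
    + pose proof (Hm n ltac:(lia)); lra.
Qed.

Fixpoint words (n : nat) : list (list bool) :=
  match n with
  | O => nil :: nil
  | S k => flat_map (fun w => (true :: w) :: (false :: w) :: nil) (words k)
  end.

Lemma in_words (w : list bool) : In w (words (length w)).
Proof.
  induction w as [|b w IH]; simpl; [tauto|].
  apply in_flat_map; exists w; split; [assumption|]; destruct b; simpl; tauto.
Qed.

Lemma lsum_words (p : R) (n : nat) (f : list bool -> R) :
  lsum (fun w => cyl_weight p w * f w) (words n) = expect p n f.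
Proof.
  revert f; induction n as [|n IH]; intros f; [simpl; ring|].
  cbn [expect words]; rewrite <- IH; generalize (words n); intros l.
  induction l as [|w l IHl]; simpl; [reflexivity|].
  simpl in IHl; rewrite IHl; ring.
Qed.

Lemma bad_words_list (p : R) (n : nat) (P : list bool -> Prop) :
  exists l, (forall w, length w = n -> P w -> In w l) /\
    lsum (cyl_weight p) l = expect p n (fun w => indic (P w)).
Proof.
  exists (filter (fun w => if excluded_middle_informative (P w) then true else false) (words n)).
  split.
  - intros w <- HP; apply filter_In; split; [apply in_words|].
    destruct excluded_middle_informative; tauto.
  - rewrite <- lsum_words; unfold indic; induction (words n) as [|w l IH]; simpl; [reflexivity|].
    destruct excluded_middle_informative; simpl; rewrite IH; ring.
Qed.

Fixpoint concat_upto {A : Type} (B : nat -> list A) (n : nat) : list A :=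
  match n with O => B O | S k => concat_upto B k ++ B (S k) end.

Lemma concat_upto_prefix {A : Type} (B : nat -> list A) (m n : nat) :
  (m <= n)%nat -> exists l, concat_upto B n = concat_upto B m ++ l.
Proof.
  intros H; induction H as [|n H [l IH]].
  - exists nil; rewrite app_nil_r; reflexivity.
  - exists (l ++ B (S n)); simpl; rewrite IH, app_assoc; reflexivity.
Qed.

(** Entries do not depend on the stage at which they are read, so the growing lists define one
    infinite enumeration. *)
Lemma concat_upto_nth {A : Type} (B : nat -> list A) (m n i : nat) (d : A) :
  (i < length (concat_upto B m))%nat -> (i < length (concat_upto B n))%nat ->
  nth i (concat_upto B m) d = nth i (concat_upto B n) d.
Proof.
  intros Hm Hn; destruct (Nat.le_ge_cases m n) as [H|H];
    destruct (concat_upto_prefix B _ _ H) as [l ->]; rewrite app_nth1 by assumption; reflexivity.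
Qed.

Lemma concat_upto_length {A : Type} (B : nat -> list A) (n : nat) :
  (forall j, B j <> nil) -> (n < length (concat_upto B n))%nat.
Proof.
  intros H; induction n as [|n IH]; simpl.
  - specialize (H 0%nat); destruct (B 0%nat); [tauto | simpl; lia].
  - rewrite length_app; specialize (H (S n)); destruct (B (S n)); [tauto | simpl; lia].
Qed.

Lemma in_concat_upto {A : Type} (B : nat -> list A) (n : nat) (a : A) :
  In a (B n) -> In a (concat_upto B n).
Proof. destruct n; simpl; intros H; [|apply in_or_app]; tauto. Qed.

(* No cylinder has weight zero, so each list is padded with the cylinder of a
   long constant word to make it nonempty. *)
Lemma bernoulli_null_lists (p : R) (E : (nat -> bool) -> Prop) :
  0 < p < 1 ->
  (forall eps, 0 < eps -> exists B : nat -> list (list bool),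
     (forall omega, E omega -> exists j w, In w (B j) /\ in_cylinder w omega) /\
     (forall j, lsum (cyl_weight p) (B j) <= eps * (/ 2) ^ j)) ->
  bernoulli_null p E.
Proof.
  (* With [eps / 8] for list [j] and as much for its padding word, both times [(/ 2) ^ j], the total
     is at most [eps / 2]. *)
  intros Hp H eps He; destruct (H (eps / 8) ltac:(lra)) as [B [HE HB]].
  assert (Hfill : forall j : nat, exists m : nat, p ^ m <= eps / 8 * (/ 2) ^ j).
  { intros j; assert (0 < (/ 2) ^ j) by (apply pow_lt; lra).
    destruct (pow_lt_1_zero p ltac:(rewrite Rabs_pos_eq; lra) (eps / 8 * (/ 2) ^ j) ltac:(nra)) as [m Hm].
    exists m; specialize (Hm m (Nat.le_refl m)); rewrite Rabs_pos_eq in Hm by (apply pow_le; lra); lra. }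
  set (fill := fun j => repeat true (proj1_sig (constructive_indefinite_description _ (Hfill j)))).
  assert (Hfw : forall j, cyl_weight p (fill j) <= eps / 8 * (/ 2) ^ j).
  { intros j; unfold fill; destruct constructive_indefinite_description as [m Hm]; simpl.
    replace (cyl_weight p (repeat true m)) with (p ^ m); [assumption|].
    clear; induction m as [|m IH]; simpl; [|rewrite IH]; reflexivity. }
  set (B' := fun j => fill j :: B j).
  assert (HB0 : forall j, B' j <> nil) by (intros j; discriminate).
  assert (Hpos : forall w, 0 <= cyl_weight p w) by (intros w; apply Rlt_le, cyl_weight_pos; assumption).
  (* Entry [k] is read at stage [k], where the nonempty lists already supply more than [k] entries,
     so the default [nil] is never reached. *)
  exists (fun k => nth k (concat_upto B' k) nil), (eps / 2); split; [|split; [|lra]].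
  - intros omega Ho; destruct (HE omega Ho) as [j [w [Hin Hw]]].
    assert (Hin' : In w (concat_upto B' j)) by (apply in_concat_upto; right; assumption).
    destruct (In_nth _ _ nil Hin') as [i [Hi Hn]]; exists i.
    rewrite (concat_upto_nth B' i j); [rewrite Hn; assumption | apply concat_upto_length; assumption | assumption].
  - intros N; apply Rle_trans with (lsum (cyl_weight p) (concat_upto B' N)).
    + eapply Rle_trans; [|apply (rsum_nth_le_lsum _ _ nil (S N)); [assumption | apply concat_upto_length; assumption]].
      apply Req_le.
      transitivity (rsum (fun k => cyl_weight p (nth k (concat_upto B' k) nil)) (S N)).
      * induction N as [|N IH]; simpl; [|rewrite IH; simpl]; ring.
      * apply rsum_ext; intros i Hi; f_equal.
        pose proof (concat_upto_length B' N HB0).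
        apply concat_upto_nth; [apply concat_upto_length; assumption | lia].
    + assert (Hj : forall j, lsum (cyl_weight p) (B' j) <= eps / 4 * (/ 2) ^ j).
      { intros j; unfold B'; simpl; pose proof (HB j); pose proof (Hfw j); lra. }
      assert (Hn : lsum (cyl_weight p) (concat_upto B' N) <= eps / 2 - eps / 4 * (/ 2) ^ N).
      { induction N as [|N IH].
        - pose proof (Hj 0%nat) as H0; simpl in *; lra.
        - cbn [concat_upto]; rewrite lsum_app; pose proof (Hj (S N)) as H1; simpl pow in *; lra. }
      assert (0 < (/ 2) ^ N) by (apply pow_lt; lra); nra.
Qed.

(** * Almost sure convergence *)

Lemma Fn_act (alpha beta : R) (omega : nat -> bool) (n : nat) (y : R) :
  Fn alpha beta omega n y = act alpha beta (map omega (seq 0 n)) y.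
Proof.
  revert y; induction n as [|n IH]; intros y; [reflexivity|].
  rewrite seq_S, map_app, act_app; simpl; apply IH.
Qed.

Lemma in_cylinder_prefix (omega : nat -> bool) (n : nat) :
  in_cylinder (map omega (seq 0 n)) omega.
Proof.
  intros i Hi; rewrite length_map, length_seq in Hi.
  rewrite (nth_indep _ false (omega 0%nat)) by (rewrite length_map, length_seq; assumption).
  rewrite map_nth, seq_nth by assumption; reflexivity.
Qed.

(** New letters are applied first, so [F_n] is [F_m] after a self-map of the circle. *)
Lemma Fn_decreasing (alpha beta : R) (omega : nat -> bool) (m n : nat) (x : R) :
  (m <= n)%nat -> image_Fn alpha beta omega n x -> image_Fn alpha beta omega m x.
Proof.
  intros H; induction H as [|n H IH]; intros Hx; [assumption|]; apply IH.
  destruct Hx as [y [Hy E]]; exists (Tsel alpha beta (omega n) y); split; [apply Tsel_bounds | assumption].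
Qed.

Lemma leb_outer_lt_mono (U V : R -> Prop) (eps eps' : R) :
  (forall x, V x -> U x) -> eps <= eps' -> leb_outer_lt U eps -> leb_outer_lt V eps'.
Proof.
  intros HUV He [a [b [l [H1 [H2 [H3 H4]]]]]]; exists a, b, l; repeat split; auto; lra.
Qed.

Theorem theorem4p2 (alpha : R) (Ha : 0 < alpha < 1) (Hirr : irrational alpha) :
  exists beta0, 0 < beta0 /\
    forall beta, irrational beta -> 0 < beta < beta0 ->
    forall p, 0 < p < 1 ->
      almost_surely p (fun omega =>
        leb_tends_to_zero (fun n => image_Fn alpha beta omega n)).
Proof.
  exists 1; split; [lra|]; intros beta Hb _ p Hp.
  apply bernoulli_null_lists; [assumption|]; intros eps He.
  assert (Heta : forall j : nat, 0 < eps * (/ 2) ^ j)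
    by (intros j; apply Rmult_lt_0_compat; [assumption | apply pow_lt; lra]).
  (* The same [eps * (/ 2) ^ j] is the measure threshold and the probability bound: the thresholds
     tend to 0 while the probabilities are summable. *)
  pose (bad := fun j w => ~ leb_outer_lt (img alpha beta w) (eps * (/ 2) ^ j)).
  assert (Hex : forall j, exists nl : nat * list (list bool),
    (forall w, length w = fst nl -> bad j w -> In w (snd nl)) /\
    lsum (cyl_weight p) (snd nl) <= eps * (/ 2) ^ j).
  { intros j; destruct (expected_bad_small alpha beta p _ Ha Hirr Hb Hp (Heta j)) as [n Hn].
    destruct (bad_words_list p n (bad j)) as [l [Hl El]].
    exists (n, l); simpl; split; [assumption | rewrite El; exact Hn]. }
  set (nl := fun j => proj1_sig (constructive_indefinite_description _ (Hex j))).
  assert (Hnl : forall j, (forall w, length w = fst (nl j) -> bad j w -> In w (snd (nl j))) /\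
    lsum (cyl_weight p) (snd (nl j)) <= eps * (/ 2) ^ j)
    by (intros j; exact (proj2_sig (constructive_indefinite_description _ (Hex j)))).
  exists (fun j => snd (nl j)); split; [|intros j; apply Hnl].
  (* A sequence outside all bad cylinders has a small image at length [fst (nl j)] for every [j];
     monotonicity extends this to all larger [n]. *)
  intros omega Ho; apply NNPP; intros No; apply Ho; intros eta Heta'.
  destruct (pow_lt_1_zero (/ 2) ltac:(rewrite Rabs_pos_eq; lra) (eta / eps)
    ltac:(apply Rdiv_lt_0_compat; lra)) as [j Hj].
  specialize (Hj j (Nat.le_refl j)); rewrite Rabs_pos_eq in Hj by (apply pow_le; lra).
  assert (Hej : eps * (/ 2) ^ j <= eta).
  { apply Rmult_lt_compat_l with (r := eps) in Hj; [|assumption].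
    replace (eps * (eta / eps)) with eta in Hj by (field; lra); lra. }
  exists (fst (nl j)); intros n Hn.
  set (w := map omega (seq 0 (fst (nl j)))).
  apply (leb_outer_lt_mono (img alpha beta w) _ (eps * (/ 2) ^ j)); [| assumption |].
  - intros x Hx; apply (Fn_decreasing _ _ _ _ _ _ Hn) in Hx; destruct Hx as [y [Hy E]].
    exists y; split; [assumption | rewrite E; apply Fn_act].
  - apply NNPP; intros Hbad; apply No; exists j, w; split.
    + apply (proj1 (Hnl j)); [unfold w; rewrite length_map, length_seq; reflexivity | exact Hbad].
    + apply in_cylinder_prefix.
Qed.
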